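(* Let $a\ge 3$ be an odd integer with $a\not\equiv 1,11,37,47,49,59\pmod{60}$. Then the polynomial $$\Delta_a(t)=\frac{t^{a+2}+1}{t+1}\cdot\frac{t^a+1}{t+1}-\frac{(a+1)^2}{4}\,t^{a-1}(t-1)^2\in\mathbb{Z}[t]$$ does not have a Fox-Milnor factorisation; that is, there is no polynomial $f\in\mathbb{Z}[t]$ with $\Delta_a(t)\doteq f(t)f(t^{-1})$.
   Context: Here $\doteq$ denotes equality in $\mathbb{Z}[t,t^{-1}]$ up to multiplication by a unit $\pm t^k$, $k\in\mathbb{Z}$. The polynomial $\Delta_a$ is (up to units) the Alexander polynomial of the pretzel knot $P_a=P(a,-a-2,-\frac{(a+1)^2}{2})$. *)

(* Defs.v *)
From HB Require Import structures.
From mathcomp Require Import all_boot all_order all_algebra.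

Set Implicit Arguments.
Unset Strict Implicit.
Unset Printing Implicit Defensive.

Import GRing.Theory.
Local Open Scope ring_scope.

(* Z[t, t^-1] is viewed inside the fraction field of Z[t]. *)
Notation laurent_frac := {fraction {poly int}}.

Definition laurent_t : laurent_frac := tofrac 'X.

(* p(u) for p in Z[t]: u is laurent_t for p(t), and laurent_t^-1 for p(t^-1). *)
Definition peval (p : {poly int}) (u : laurent_frac) : laurent_frac :=
  (map_poly intr p).[u].

Definition doteq (x y : laurent_frac) : Prop :=
  exists (s : bool) (k : int), x = (-1) ^+ s * laurent_t ^ k * y.

Definition has_Fox_Milnor_factorisation (p : {poly int}) : Prop :=
  exists f : {poly int},
    doteq (peval p laurent_t) (peval f laurent_t * peval f laurent_t^-1).

(* For odd a all three divisions are exact, see [tofrac_Delta]. *)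
Definition Delta (a : nat) : {poly int} :=
  (('X^(a + 2) + 1) %/ ('X + 1)) * (('X^a + 1) %/ ('X + 1))
  - ((a + 1) ^ 2 %/ 4)%N%:R * 'X^(a - 1) * ('X - 1) ^+ 2.

Lemma horner_map_intr (S : comNzRingType) (g : {rmorphism {poly int} -> S}) p :
  (map_poly intr p).[g 'X] = g p.
Proof.
elim/poly_ind: p => [|p c IH]; first by rewrite map_poly0 horner0 rmorph0.
rewrite rmorphD rmorphM /= map_polyX map_polyC /= hornerD hornerMX hornerC IH.
rewrite [RHS]rmorphD [in RHS]rmorphM; congr (_ + _).
by rewrite -[c in RHS]intz !rmorph_int.
Qed.

Lemma peval_t (p : {poly int}) : peval p laurent_t = tofrac p.
Proof. exact: (horner_map_intr (@tofrac {poly int})). Qed.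

Lemma divXD1_exact (n : nat) : odd n ->
  (('X^n + 1) %/ ('X + 1)) * ('X + 1) = 'X^n + 1 :> {poly int}.
Proof.
move=> on.
have mon : ('X + 1 : {poly int}) \is monic by exact: (monicXaddC 1).
apply/esym/eqP; rewrite -(Pdiv.IdomainMonic.dvdp_eq mon).
have -> : ('X + 1 : {poly int}) = 'X - (-1)%:P by rewrite polyCN opprK.
by rewrite dvdp_XsubCl /root !hornerE -signr_odd on expr1 addNr.
Qed.

Lemma map_Delta (S : fieldType) (g : {rmorphism {poly int} -> S}) (a : nat) :
  odd a -> g 'X + 1 != 0 -> 4%:R != 0 :> S ->
  g (Delta a) =
    (g 'X ^+ (a + 2) + 1) / (g 'X + 1) * ((g 'X ^+ a + 1) / (g 'X + 1))
    - (a%:R + 1) ^+ 2 / 4%:R * g 'X ^+ (a - 1) * (g 'X - 1) ^+ 2.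
Proof.
move=> oa nz nz4.
have D n : odd n -> g (('X^n + 1) %/ ('X + 1)) = (g 'X ^+ n + 1) / (g 'X + 1).
  move=> on; apply: (mulIf nz); rewrite divfK //.
  by rewrite -(rmorph1 g) -rmorphXn -!rmorphD -rmorphM divXD1_exact.
rewrite /Delta rmorphB !rmorphM !rmorphXn rmorphB rmorph1 rmorph_nat.
rewrite !D ?oddD ?oa //; congr (_ - _ * _ * _); apply: (mulIf nz4).
rewrite divfK // -natrM divnK ?natrX ?natrD //.
rewrite -(odd_double_half a) oa addnC addnA -muln2 -[(1 + 1)%N]/(1 * 2)%N.
by rewrite -mulnDl expnMn dvdn_mull.
Qed.

Lemma tofrac_Delta (a : nat) : odd a ->
  let t := laurent_t in
  tofrac (Delta a) =
    (t ^+ (a + 2) + 1) / (t + 1) * ((t ^+ a + 1) / (t + 1))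
    - (a%:R + 1) ^+ 2 / 4%:R * t ^+ (a - 1) * (t - 1) ^+ 2.
Proof.
move=> oa t; apply: (map_Delta (g := @tofrac {poly int})) => //.
  by rewrite -tofrac1 -tofracD tofrac_eq0 monic_neq0 // (monicXaddC 1).
by rewrite -(rmorph_nat (@tofrac {poly int})) tofrac_eq0 -polyC_natr polyC_eq0.
Qed.

(* Main.v *)
(* Put m = (a + 1) / 2. If a prime p divides m then, modulo p, Delta_a equals
   (t^(a+2) + 1)(t^a + 1) / (t + 1)^2, whose roots are simple. Suppose moreover
   that some d > 1 dividing a or a + 2 divides p^k + 1. For a root of unity
   zeta <> 1 of order dividing d, u = - zeta is a root of Delta_a modulo p, and
   the p^k-th power map sends u to u^-1; in a factorisation f(t) f(t^-1) the root
   u would thus be shared by both factors, hence be multiple.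
   The congruence conditions on a supply such p and d: if 3 | a then m is 2 mod 3,
   so some prime p | m is 2 mod 3 and d = 3 works; if 5 | a or 5 | a + 2 then m is
   not 1 mod 5 and d = 5 works in the same way; if a is 7 mod 12, take p = 2 and
   d = 3; if a is 5 mod 12, take p = 3 and d a prime factor of a that is 5 or 7
   mod 12, modulo which 3 is not a square. *)
Require Import Defs.
From HB Require Import structures.
From mathcomp Require Import all_boot all_order all_algebra.
From mathcomp Require Import cyclic closed_field finfield.
From mathcomp Require Import ring zify.

Set Implicit Arguments.
Unset Strict Implicit.
Unset Printing Implicit Defensive.

Import GRing.Theory.
Local Open Scope ring_scope.

(** * Fox-Milnor factorisations without negative powers of t *)

(** [g] is [f] with its coefficients reversed. Quantifying over all fields lets one [g] serve both
    in the fraction field of Z[t] and in characteristic p. *)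
Lemma reversed_poly (f : {poly int}) :
  exists (g : {poly int}) (n : nat), forall (F : fieldType) (u : F), u != 0 ->
    (map_poly intr g).[u] = u ^+ n * (map_poly intr f).[u^-1].
Proof.
elim/poly_ind: f => [|f c [g [n IH]]].
  by exists 0, 0%N => F u _; rewrite !rmorph0 !horner0 mulr0.
exists (g + c%:P * 'X^(n.+1)), n.+1 => F u u0.
rewrite !rmorphD !rmorphM /= !map_polyC !map_polyXn !map_polyX /=.
rewrite hornerD hornerM hornerC hornerXn hornerD hornerMX hornerC IH //.
by rewrite exprSr; field.
Qed.

(** Multiplying by t^n, and by a further power of t if the unit has a negative exponent, gives an
    identity in Z[t], which can be reduced modulo p. *)
Lemma Fox_Milnor_poly (p : {poly int}) : has_Fox_Milnor_factorisation p ->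
  exists (f g : {poly int}) (s : bool) (i j n : nat),
    'X^j * p = (-1) ^+ s * 'X^i * (f * g) /\
    forall (F : fieldType) (u : F), u != 0 ->
      (map_poly intr g).[u] = u ^+ n * (map_poly intr f).[u^-1].
Proof.
move=> [f [s [k E]]]; have [g [n gE]] := reversed_poly f.
have t0 : laurent_t != 0 by rewrite /laurent_t tofrac_eq0 polyX_eq0.
have {}E : laurent_t ^+ n * tofrac p =
    (-1) ^+ s * laurent_t ^ k * (tofrac f * tofrac g).
  rewrite -(peval_t g) /peval gE // -!peval_t E /peval.
  by ring.
have inj q r : tofrac q = tofrac r -> q = r :> {poly int}.
  by move/eqP; rewrite tofrac_eq => /eqP.
case: k E => k.
  exists f, g, s, k, n, n; split=> //; apply: inj.
  by rewrite !rmorphM !rmorphXn rmorphN rmorph1.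
rewrite NegzE -exprnN => E.
exists f, g, s, 0%N, (k.+1 + n)%N, n; split=> //; apply: inj.
rewrite !rmorphM !rmorphXn rmorphN !rmorph1 exprD -mulrA E expr0.
by rewrite mulr1 -[_ / _ * _]mulrA mulrCA mulVKf ?expf_neq0.
Qed.

(** * Frobenius and roots of unity in characteristic p *)

Lemma horner_map_intr_pchar (K : fieldType) (p k : nat) (f : {poly int})
    (u : K) : p \in [pchar K] ->
  (map_poly intr f).[u ^+ (p ^ k)] = (map_poly intr f).[u] ^+ (p ^ k).
Proof.
move=> pK; elim: k => [|k IH]; first by rewrite !expr1.
rewrite expnSr !exprM -IH -!(pFrobenius_autE pK).
rewrite -(horner_map (pFrobenius_aut pK)) -map_poly_comp.
congr _.[_]; apply: eq_map_poly => c /=.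
by rewrite pFrobenius_aut_int.
Qed.

Lemma pchar_closed_field (p : nat) : prime p ->
  exists K : closedFieldType, p \in [pchar K].
Proof.
move=> p_pr; have [K [h _]] := countable_algebraic_closure 'F_p.
by exists K; rewrite (fmorph_pchar h) pchar_Fp.
Qed.

(** Any root of 1 + x + ... + x^(d-1) works, since this sum takes the nonzero value d at 1. *)
Lemma nontrivial_unity_root (K : closedFieldType) (d : nat) : (1 < d)%N ->
  d%:R != 0 :> K -> exists2 z : K, z ^+ d = 1 & z != 1.
Proof.
move=> d1 d0; pose P : {poly K} := \poly_(i < d) 1.
have sP : size P = d by rewrite size_poly_eq // oner_eq0.
have /closed_rootP[z /rootP Pz] : size P != 1%N.
  by rewrite sP; case: d d1 {d0 P sP} => [|[]].
have Pe x : P.[x] = \sum_(i < d) x ^+ i.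
  by rewrite horner_poly; apply: eq_bigr => i _; rewrite mul1r.
exists z; first by apply/eqP; rewrite -subr_eq0 subrX1 -Pe Pz mulr0.
apply: contraNneq d0 => z1; rewrite -Pz Pe z1.
by under eq_bigr do rewrite expr1n; rewrite sumr_const card_ord.
Qed.

(** * The obstruction at a prime dividing (a + 1) / 2 *)

Lemma Delta_mulXD1sqr (a : nat) : odd a ->
  Delta a * ('X + 1) ^+ 2 = ('X^(a + 2) + 1) * ('X^a + 1) -
    (a.+1./2 ^ 2)%N%:R * 'X^(a - 1) * ('X - 1) ^+ 2 * ('X + 1) ^+ 2.
Proof.
move=> oa; rewrite /Delta.
have aE : (a + 1 = a.+1./2 * 2)%N by lia.
have -> : ((a + 1) ^ 2 %/ 4 = a.+1./2 ^ 2)%N by rewrite aE expnMn mulnK.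
have := divXD1_exact oa; have := @divXD1_exact (a + 2).
set A := _ %/ _; set B := _ %/ _ => <-; rewrite ?oddD ?oa // => <-.
move: A B => A B; ring.
Qed.

Lemma Delta_not_Fox_Milnor (a p d k : nat) : odd a -> prime p ->
    (p %| a.+1./2)%N -> (1 < d)%N -> (d %| a)%N || (d %| a + 2)%N ->
    (d %| (p ^ k).+1)%N ->
  ~ has_Fox_Milnor_factorisation (Delta a).
Proof.
move=> oa p_pr pa d1 da dpk /Fox_Milnor_poly[f [g [s [i [j [n [E gE]]]]]]].
have [K pK] := pchar_closed_field p_pr.
have a1K : a%:R = -1 :> K.
  apply/eqP; rewrite -subr_eq0 opprK natr1 -(dvdn_pcharf pK).
  have -> : a.+1 = (a.+1./2 * 2)%N by lia.
  exact: dvdn_mulr.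
have od : odd d by case/orP: da => /dvdn_odd; apply; rewrite ?oddD ?oa.
(* If p divided d, it would divide a or a + 2, which are -1 and 1 in [K]. *)
have d0 : d%:R != 0 :> K.
  rewrite -(dvdn_pcharf pK); apply/negP => pd.
  suff : 1%:R == 0 :> K by rewrite oner_eq0.
  case/orP: da => /(dvdn_trans pd); rewrite (dvdn_pcharf pK) ?natrD a1K.
    by rewrite oppr_eq0.
  by rewrite (_ : -1 + 2%:R = 1%:R) //; ring.
have [z zd z1] := nontrivial_unity_root d1 d0.
have z0 : z != 0.
  have dn0 : (d == 0)%N = false by lia.
  by apply: contra_eq_neq zd => ->; rewrite expr0n dn0 eq_sym oner_eq0.
pose u := - z.
have u0 : u != 0 by rewrite oppr_eq0.
have zm m : (d %| m)%N -> z ^+ m = 1.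
  by move=> /dvdnP[q ->]; rewrite mulnC exprM zd expr1n.
have um m : odd m -> (d %| m)%N -> u ^+ m = -1.
  by move=> om dm; rewrite exprNn -signr_odd om expr1 zm // mulr1.
(* As d is odd, z^2 = 1 and z^d = 1 would force z = 1. *)
have u2 : u ^+ 2 != 1.
  apply: contraNneq z1; rewrite sqrrN => z2.
  by rewrite -zd -(odd_double_half d) od exprS -mul2n exprM z2 expr1n mulr1.
(* The sign (-1)^(p^k + 1) is 1: the exponent is even for odd p, and -1 = 1 in [K] for p = 2. *)
have uF : u ^+ (p ^ k) = u^-1.
  apply: (mulfI u0); rewrite divff // -exprS.
  rewrite exprNn zm // mulr1 -signr_odd /= oddX.
  case: (p_pr) => /even_prime[p2|->]; last by rewrite orbT.
  have : 2%:R == 0 :> K by rewrite -(dvdn_pcharf pK) p2.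
  case: ((k == 0)%N || _) => //=; rewrite expr1 => /eqP e.
  by apply/eqP; rewrite eq_sym -subr_eq0 opprK -[1 + 1]/(2%:R) e.
have [N NE] : exists N : {poly K}, N = ('X^(a + 2) + 1) * ('X^a + 1).
  by eexists.
have EK : 'X^j * N =
    (-1) ^+ s * 'X^i * ('X + 1) ^+ 2 * (map_poly intr f * map_poly intr g).
  have : 'X^j * (Delta a * ('X + 1) ^+ 2) =
      (-1) ^+ s * 'X^i * (f * g) * ('X + 1) ^+ 2 by rewrite mulrA E.
  rewrite Delta_mulXD1sqr // => /(congr1 (map_poly (intr : int -> K))).
  rewrite !(rmorphM, rmorphB, rmorphD, rmorphXn).
  rewrite rmorphN !rmorph1 rmorph_nat /= !map_polyX.
  have -> : (uphalf a)%:R = 0 :> {poly K}.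
    rewrite -polyC_natr (_ : _%:R = 0) //.
    by apply/eqP; rewrite -(dvdn_pcharf pK).
  by rewrite NE !mul0r subr0 => ->; ring.
have Nu : N.[u] = 0.
  rewrite NE !hornerE; case/orP: da => dm; first by rewrite (um a) // addNr mulr0.
  by rewrite um ?addNr ?mul0r // oddD oa.
have gu : (map_poly intr g).[u] = u ^+ n * (map_poly intr f).[u] ^+ (p ^ k).
  by rewrite gE // -horner_map_intr_pchar // uF.
(* Evaluating [EK] at u gives f(u) * f(u)^(p^k) = 0, since u and u + 1 are nonzero. *)
have fu : (map_poly intr f).[u] = 0.
  have := congr1 (horner^~ u) EK; rewrite hornerM Nu mulr0 !hornerM gu.
  rewrite !horner_exp !hornerE => /esym/eqP.
  have u1 : u + 1 != 0.
    apply: contraNneq u2 => /eqP; rewrite addr_eq0 => /eqP->.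
    by rewrite sqrrN expr1n.
  rewrite !mulf_eq0 !expf_eq0 oppr_eq0 oner_eq0 (negPf u0) (negPf u1) !andbF /=.
  by rewrite orbF => /orP[|/andP[_]] /eqP.
have {}gu : (map_poly intr g).[u] = 0.
  by rewrite gu fu expr0n expn_eq0 -leqn0 leqNgt prime_gt0 //= mulr0.
(* By the product rule, as [f] and [g] both vanish at u. *)
have N'u : N^`().[u] = 0.
  have := congr1 (fun q => q^`().[u]) EK.
  rewrite !derivM !(hornerD, hornerM) Nu fu gu.
  rewrite !(mulr0, mul0r, addr0, add0r) hornerXn => /eqP.
  by rewrite mulf_eq0 expf_eq0 (negPf u0) andbF => /eqP.
(* With a = -1 in [K], N'(u) is -u^(a-1) (1 - u^2) if d divides a, and u^(a+1) (u^a + 1) if d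
   divides a + 2. Either one vanishes only if u^2 = 1. *)
move: N'u; rewrite NE derivM !derivD !derivXn !derivC !addr0.
rewrite !(hornerD, hornerM, hornerMn, hornerXn, hornerC).
rewrite -[_ *+ a]mulr_natr -[_ *+ (a + 2)]mulr_natr natrD a1K.
have two1 : -1 + 2%:R = 1 :> K by ring.
case/orP: da => dm /eqP.
  rewrite (um a) // addNr mulr0 add0r mulrN1 mulrN oppr_eq0 mulf_eq0 expf_eq0.
  rewrite (negPf u0) andbF orbF exprD um // mulN1r addrC subr_eq0 eq_sym.
  by apply/negP.
have u2a : u ^+ (a + 2) = -1 by rewrite um // oddD oa.
rewrite u2a two1 addNr mul0r addr0 mulr1 mulf_eq0 expf_eq0 (negPf u0) andbF /=.
rewrite addr_eq0 => /eqP ua; move: u2a; rewrite exprD ua mulN1r => /oppr_inj.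
by apply/eqP.
Qed.

(** * Prime factors in residue classes, and the quadratic character of 3 *)

Lemma prime_divisor_notin (P : pred nat) (m : nat) :
    P 1%N -> (forall x y, P x -> P y -> P (x * y)%N) ->
  (0 < m)%N -> ~~ P m -> exists p, [/\ prime p, (p %| m)%N & ~~ P p].
Proof.
move=> P1 PM; have [n] := ubnP m; elim: n m => // n IH m mn m0 Pm.
have m1 : (1 < m)%N by case: m {mn} m0 Pm => [|[]] //; rewrite P1.
have [Pp|] := boolP (P (pdiv m)); last first.
  by move=> ?; exists (pdiv m); rewrite pdiv_prime ?pdiv_dvd.
have [||| p [p_pr pm Np]] := IH (m %/ pdiv m)%N.
- by apply: leq_trans (mn : (m <= n)%N); rewrite ltn_Pdiv ?prime_gt1 ?pdiv_prime.
- by rewrite divn_gt0 ?pdiv_gt0 // dvdn_leq ?pdiv_dvd.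
- apply: contra Pm => Pm; rewrite -(divnK (pdiv_dvd m)); exact: PM.
exists p; split=> //; apply: dvdn_trans pm _; exact: dvdn_div (pdiv_dvd m).
Qed.

Lemma finField_fermat (F : finFieldType) (x : F) : x != 0 -> x ^+ #|F|.-1 = 1.
Proof.
move=> x0; apply: (mulfI x0); rewrite -exprS prednK ?expf_card ?mulr1 //.
exact: ltnW (finNzRing_gt1 F).
Qed.

Lemma finField_prim_root (F : finFieldType) :
  exists z : F, #|F|.-1.-primitive_root z.
Proof.
pose rs := [seq x <- enum F | x != 0].
have /hasP[z _ ?] : has #|F|.-1.-primitive_root rs; last by exists z.
apply: has_prim_root.
- by have := finNzRing_gt1 F; case: #|F| => [|[]].
- apply/allP => x; rewrite mem_filter => /andP[x0 _].
  by apply/unity_rootP; rewrite finField_fermat.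
- by rewrite filter_uniq ?enum_uniq.
rewrite size_filter; have := count_predC (pred1 0) (enum F).
by rewrite count_uniq_mem ?enum_uniq // mem_enum -cardE => <-.
Qed.

(* Since - 3 = (2 w + 1)^2 for a primitive cube root of unity w, - 3 is a square
   exactly when 3 divides #|F| - 1. *)
Lemma finField_three_not_square (F : finFieldType) : 2%:R != 0 :> F ->
    3%:R != 0 :> F -> (#|F| %% 12)%N \in [:: 5; 7]%N ->
  3%:R ^+ #|F|.-1./2 = -1 :> F.
Proof.
move=> two0 three0 F12; have [z zP] := finField_prim_root F.
pose h := #|F|.-1./2; have hE : #|F|.-1 = (h * 2)%N.
  by move: F12; rewrite /h !inE; lia.
have h0 : (0 < h)%N by move: F12; rewrite /h !inE; lia.
rewrite -/h; have [F5|F7] : (#|F| %% 12 = 5 \/ #|F| %% 12 = 7)%N.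
  by move: F12; rewrite !inE => /orP[]/eqP; [left|right].
(* Here h is even, so 3^h = 1 would give (-3)^h = 1 and make -3 a square; the resulting cube root of
   unity [w] must be 1 because 3 does not divide #|F| - 1, whence 3 = 0. *)
- have : (3%:R ^+ h) ^+ 2 == 1 :> F by rewrite -exprM -hE finField_fermat.
  rewrite sqrf_eq1 => /orP[/eqP xh|/eqP//]; exfalso.
  have oh : odd h = false by rewrite /h; lia.
  have xh' : (- 3%:R) ^+ h = 1 :> F by rewrite exprNn xh mulr1 -signr_odd oh.
  have [i iE] : {i : 'I_#|F|.-1 | - 3%:R = z ^+ i}.
    by apply: (prim_rootP zP); rewrite hE exprM xh' expr1n.
  have /dvdnP[c cE] : (2 %| i)%N.
    have: (h * 2 %| i * h)%N.
      by rewrite -hE (prim_order_dvd zP) exprM -iE xh'.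
    by rewrite mulnC dvdn_pmul2r.
  pose y := z ^+ c; have yy : y ^+ 2 = - 3%:R by rewrite iE cE exprM.
  pose w := (y - 1) / 2%:R.
  have w0 : w ^+ 2 + w + 1 = 0.
    have -> : w ^+ 2 + w + 1 = (y ^+ 2 + 3%:R) / 2%:R ^+ 2.
      by rewrite /w; field; rewrite (natrM F 2 2) mulf_neq0 two0.
    by rewrite yy addNr mul0r.
  have w3 : w ^+ 3 = 1.
    apply/eqP; rewrite -subr_eq0.
    have -> : w ^+ 3 - 1 = (w - 1) * (w ^+ 2 + w + 1) by ring.
    by rewrite w0 mulr0.
  have wn0 : w != 0.
    by apply: contra_eq_neq w3 => ->; rewrite expr0n eq_sym oner_eq0.
  have w1 : w = 1.
    have := finField_fermat wn0.
    have -> : (#|F|.-1 = 3 * (#|F|.-1 %/ 3) + 1)%N by lia.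
    by rewrite exprD exprM w3 expr1n mul1r.
  by move/eqP: w0; rewrite w1 expr1n -[1 + 1]/(2%:R) natr1 (negPf three0).
(* Here 3 divides #|F| - 1, so -3 is a square and (-3)^h = 1; as h is odd, 3^h = -1. *)
- pose w := z ^+ (#|F|.-1 %/ 3).
  have w3 : w ^+ 3 = 1.
    rewrite -exprM; have -> : (#|F|.-1 %/ 3 * 3 = #|F|.-1)%N by lia.
    exact: prim_expr_order.
  have wn1 : w - 1 != 0.
    by rewrite subr_eq0 -(prim_order_dvd zP); apply/negP => /dvdn_leq; lia.
  have w0 : w ^+ 2 + w + 1 = 0.
    apply: (mulfI wn1); rewrite mulr0.
    have -> : (w - 1) * (w ^+ 2 + w + 1) = w ^+ 3 - 1 by ring.
    by rewrite w3 subrr.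
  have yy : (2%:R * w + 1) ^+ 2 = - 3%:R.
    apply/eqP; rewrite -subr_eq0 opprK.
    have -> : (2%:R * w + 1) ^+ 2 + 3%:R = 4%:R * (w ^+ 2 + w + 1) by ring.
    by rewrite w0 mulr0.
  have y0 : 2%:R * w + 1 != 0.
    by apply: contra_eq_neq yy => ->; rewrite expr0n eq_sym oppr_eq0.
  have := finField_fermat y0; rewrite hE mulnC exprM yy exprNn -signr_odd.
  have -> : odd h by rewrite /h; lia.
  by rewrite expr1 mulN1r => /eqP; rewrite eqr_oppLR => /eqP.
Qed.

(** This supplies d = q and k = (q - 1) / 2 for the obstruction at p = 3. *)
Lemma prime_dvd_three_expS (q : nat) : prime q -> (q %% 12)%N \in [:: 5; 7]%N ->
  (q %| (3 ^ q.-1./2).+1)%N.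
Proof.
move=> q_pr q12; have qC := pchar_Fp q_pr.
have small n : (0 < n < 5)%N -> n%:R != 0 :> 'F_q.
  move=> n5; rewrite -(dvdn_pcharf qC); apply/negP => /dvdn_leq.
  by move: q12; rewrite !inE; lia.
have := @finField_three_not_square 'F_q; rewrite card_Fp // => x3.
by rewrite (dvdn_pcharf qC) -natr1 natrX x3 ?addNr ?small.
Qed.

(** * Choice of p, d and k according to the residue of a *)

Theorem theorem4p5 (a : nat) (ha : (3 <= a)%N) (hodd : odd a)
  (hmod : (a %% 60)%N \notin [:: 1; 11; 37; 47; 49; 59]%N) :
  ~ has_Fox_Milnor_factorisation (Delta a).
Proof.
pose m := a.+1./2; have m0 : (0 < m)%N by rewrite /m; lia.
have aE : a.+1 = (m * 2)%N by rewrite /m; lia.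
have key p d k := @Delta_not_Fox_Milnor a p d k hodd.
have pow1 d p k c : ((p %% d) ^ k %% d = c -> (c + 1) %% d = 0 ->
    d %| (p ^ k).+1)%N.
  by move=> pk c1; rewrite /dvdn -addn1 -modnDml -modnXm pk c1.
have divisor d : (1 < d)%N -> (m %% d != 1)%N ->
    exists p, [/\ prime p, (p %| m)%N & (p %% d != 1)%N].
  move=> d1 md; apply: (@prime_divisor_notin (fun x => x %% d == 1)%N) => //.
    by rewrite modn_small.
  by move=> x y /eqP xd /eqP yd; rewrite -modnMm xd yd modn_small.
have [a3|a3] := boolP (3 %| a)%N.
  have m3 : (m %% 3 != 1)%N by lia.
  have [p [p_pr pm p3]] := divisor 3 isT m3.
  apply: (key p 3 1)%N => //; first by rewrite a3.
  have p0 : (p %% 3 != 0)%N by apply: contraTneq pm => p0; apply/negP; lia.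
  by apply: pow1; [reflexivity | lia].
have [a5|a5] := boolP ((5 %| a) || (5 %| a + 2))%N.
  have m5 : (m %% 5 != 1)%N by lia.
  have [p [p_pr pm p5]] := divisor 5 isT m5.
  have p0 : (p %% 5 != 0)%N.
    apply: contraTneq pm => /eqP; rewrite -/(dvdn 5 p) => p0.
    by apply/negP => /(dvdn_trans p0); lia.
  (* -1 is p itself modulo 5 in the first case and p^2 in the other two. *)
  have [p4|[p2|p3]] : (p %% 5 = 4 \/ p %% 5 = 2 \/ p %% 5 = 3)%N by lia.
  - by apply: (key p 5 1)%N => //; apply: pow1; rewrite ?p4.
  - by apply: (key p 5 2)%N => //; apply: pow1; rewrite ?p2.
  - by apply: (key p 5 2)%N => //; apply: pow1; rewrite ?p3.
(* The excluded residues modulo 60 are exactly the remaining ones that are 1 or 11 modulo 12. *)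
have [a12|a12] : (a %% 12 = 5 \/ a %% 12 = 7)%N.
  by move: hmod a3 a5; rewrite !inE; lia.
(* The classes 1 and 11 modulo 12 are closed under products, so some prime factor of a lies outside
   them; it is neither 2 nor 3. *)
- have [|x y|||q [q_pr qa q12]] :=
    @prime_divisor_notin (fun x => x %% 12 \in [:: 1; 11])%N a.
  + by [].
  + by rewrite -modnMm !inE => /orP[]/eqP-> /orP[]/eqP->.
  + by lia.
  + by rewrite a12.
  apply: (key 3 q q.-1./2)%N; rewrite ?qa ?prime_gt1 //; first by lia.
  apply: prime_dvd_three_expS => //.
  have q2 : (q %% 2 != 0)%N.
    apply: contraTneq hodd => /eqP; rewrite -/(dvdn 2 q) => q2.
    by move: (dvdn_trans q2 qa); rewrite dvdn2.
  have q3 : (q %% 3 != 0)%N.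
    apply: contraNneq a3 => /eqP; rewrite -/(dvdn 3 q) => q3.
    exact: dvdn_trans q3 qa.
  by move: q12; rewrite !inE; lia.
- by apply: (key 2 3 1)%N => //; lia.
Qed.
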